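(* Let $G$ be a finite simple graph with vertex set $[n]=\{1,\dots,n\}$ and let $k\ge 1$ be an integer. Then the $k$-balanced chromatic quasisymmetric function $X_G^k$ is $L$-positive; that is, in the expansion $X_G^k=\sum_{\alpha\models n} c_\alpha L_\alpha$ of $X_G^k$ in the fundamental basis $\{L_\alpha\}_{\alpha\models n}$ of the homogeneous quasisymmetric functions of degree $n$, every coefficient $c_\alpha$ is nonnegative.
   Context: $\mathbb{P}$ denotes the positive integers. An orientation of a simple graph $G$ is a directed graph on the same vertices containing, for each edge $\{i,j\}$ of $G$, exactly one of $(i,j)$, $(j,i)$ (and no other edges). For $k\ge1$, an orientation $\mathcal{O}$ of $G$ is $k$-balanced if for every cycle of $G$ with edges $\{v_1,v_2\},\{v_2,v_3\},\dots,\{v_{r-1},v_r\},\{v_r,v_1\}$, $\mathcal{O}$ contains at least $k$ directed edges of the form $(v_i,v_{i+1})$ and at least $k$ directed edges of the form $(v_{i+1},v_i)$ (subscripts modulo $r$). A proper coloring of $G$ is a map $\kappa:V(G)\to\mathbb{P}$ with $\kappa(i)\ne\kappa(j)$ whenever $\{i,j\}$ is an edge. The orientation $\mathcal{O}_\kappa$ induced by a proper coloring $\kappa$ directs each edge toward the endpoint with the greater color; $\kappa$ is a $k$-balanced coloring if $\mathcal{O}_\kappa$ is $k$-balanced. The $k$-balanced chromatic quasisymmetric function of $G$ (with $V(G)=[n]$) is $$X_G^k=X_G^k(x_1,x_2,\dots)=\sum_{\kappa}x_{\kappa(1)}x_{\kappa(2)}\cdots x_{\kappa(n)},$$ summed over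 all $k$-balanced colorings $\kappa:V(G)\to\mathbb{P}$; it is a quasisymmetric function, homogeneous of degree $n$, in commuting indeterminates $x_1,x_2,\dots$. A composition $\alpha=(\alpha_1,\dots,\alpha_\ell)$ of $n$ (written $\alpha\models n$) is an ordered list of positive integers with sum $n$; set $S_\alpha=\{\alpha_1,\alpha_1+\alpha_2,\dots,\alpha_1+\cdots+\alpha_{\ell-1}\}\subseteq[n-1]$. The fundamental basis of the space of quasisymmetric functions of degree $n$ consists of $$L_\alpha=\sum_{\substack{i_1\le i_2\le\cdots\le i_n\\ i_j<i_{j+1}\text{ if }j\in S_\alpha}}x_{i_1}x_{i_2}\cdots x_{i_n},\qquad \alpha\models n.$$ *)

(* Defs.v *)
From HB Require Import structures.
From mathcomp Require Import all_boot all_order all_algebra finmap monalg.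
From mathcomp Require Import boolp classical_sets functions cardinality fsbigop.

Set Implicit Arguments.
Unset Strict Implicit.
Unset Printing Implicit Defensive.

Import GRing.Theory Num.Theory.
Local Open Scope classical_set_scope.
Local Open Scope ring_scope.

(* The positive integers: colors, and indices of the indeterminates. *)
Definition posint := {m : nat | (0 < m)%N}.

HB.instance Definition _ := Countable.on posint.

(* Families of coefficients, indexed by the (finitely supported, commutative)
   monomials; [rat^o] provides the pointwise rat-module structure. *)
Definition series := {cmonom posint} -> rat^o.

HB.instance Definition _ := GRing.Lmodule.on series.

Definition word_monom n (i : {ffun 'I_n -> posint}) : {cmonom posint} :=
  \big[mmul/mone]_(j < n) ucm (i j).

(* The support of the sum defining a coefficient of [word_series] is finite by
   this lemma, so this sum over a classical set never takes its junk value. *)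
Lemma finite_word_monom n (m : {cmonom posint}) :
  finite_set [set i : {ffun 'I_n -> posint} | word_monom i = m].
Proof.
pose f (g : {ffun 'I_n -> finsupp m}) : {ffun 'I_n -> posint} :=
  [ffun j => fsval (g j)].
apply: (@sub_finite_set _ _ (f @` setT)); last first.
  by apply: finite_image; apply: finite_finset.
move=> i /= im.
have Hi j : i j \in finsupp m.
  by rewrite -im -cmE_neq0 /word_monom (bigD1 j) //= cmM cmU eqxx.
exists [ffun j => [` Hi j]%fset] => //.
by apply/ffunP => j; rewrite !ffunE.
Qed.

(* The formal sum of x_{i(1)} ... x_{i(n)} over i in A: the coefficient at m is
   the number of i in A with monomial m. *)
Definition word_series n (A : set {ffun 'I_n -> posint}) : series :=
  fun m => \sum_(i \in A) ((word_monom i == m)%:R : rat).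

Record composition n := Composition {
  parts :> seq nat;
  _ : (0%N \notin parts) && (sumn parts == n)
}.

HB.instance Definition _ n := [isSub for @parts n].
HB.instance Definition _ n := [Countable of composition n by <:].

Section FiniteComposition.
Variable n : nat.

Lemma leq_sumn_mem (s : seq nat) x : x \in s -> (x <= sumn s)%N.
Proof.
elim: s => //= y s IHs; rewrite in_cons => /predU1P[->|/IHs]; first exact: leq_addr.
by move/leq_trans; apply; apply: leq_addl.
Qed.

Lemma size_composition (a : composition n) : (size a <= n)%N.
Proof.
case: a => s /= /andP[s0 /eqP <-].
elim: s s0 => //= y s IHs; rewrite in_cons negb_or eq_sym -lt0n => /andP[y0 /IHs].
by rewrite -add1n; apply: leq_add.
Qed.

Definition encode_composition (a : composition n) : {bseq n of 'I_n.+1} :=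
  insub_bseq n [seq inord x | x <- parts a].

Definition decode_composition (b : {bseq n of 'I_n.+1}) : option (composition n) :=
  insub [seq val x | x <- b].

Lemma encode_compositionK : pcancel encode_composition decode_composition.
Proof.
move=> a; rewrite /decode_composition /encode_composition /insub_bseq val_insubd.
rewrite size_map size_composition -map_comp.
rewrite (_ : [seq _ | _ <- _] = parts a) ?valK //.
rewrite -[RHS]map_id; apply/eq_in_map => x xa /=; rewrite inordK // ltnS.
by case: a xa => s /= /andP[_ /eqP <-]; apply: leq_sumn_mem.
Qed.

HB.instance Definition _ : isFinite (composition n) :=
  PCanIsFinite encode_compositionK.

End FiniteComposition.

(* S_a, the set of the proper nonempty partial sums. *)
Definition partial_sums n (a : composition n) : seq nat :=
  [seq sumn (take l a) | l <- iota 1 (size a).-1].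

(* The condition on i_1, ..., i_n. A word is indexed by 'I_n = {0, ..., n-1},
   so that the entry i_j is the value at j-1. *)
Definition fundamental_word n (a : composition n)
    (i : {ffun 'I_n -> posint}) : Prop :=
  forall u v : 'I_n, val v = (val u).+1 ->
    (val (i u) <= val (i v))%N /\
    ((val u).+1 \in partial_sums a -> (val (i u) < val (i v))%N).

Definition fundamental n (a : composition n) : series :=
  word_series [set i | fundamental_word a i].

Definition L_expansion n (F : series) (c : composition n -> rat) : Prop :=
  F = \sum_a c a *: fundamental a.

Definition L_positive n (F : series) : Prop :=
  exists2 c : composition n -> rat,
    unique (L_expansion F) c & forall a, 0 <= c a.

Definition is_orientation n (G O : rel 'I_n) : Prop :=
  (forall u v, O u v -> G u v) /\ (forall u v, G u v -> O u v (+) O v u).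

(* A cycle is the sequence of its r >= 3 pairwise distinct vertices; [next s v]
   is the cyclic successor of v in s. *)
Definition k_balanced n (k : nat) (G O : rel 'I_n) : Prop :=
  is_orientation G O /\
  forall s : seq 'I_n, (2 < size s)%N -> ucycle G s ->
    (k <= count (fun v => O v (next s v)) s)%N /\
    (k <= count (fun v => O (next s v) v) s)%N.

Definition proper_coloring n (G : rel 'I_n) (kappa : {ffun 'I_n -> posint}) :
    Prop :=
  forall u v, G u v -> kappa u != kappa v.

Definition induced_orientation n (G : rel 'I_n)
    (kappa : {ffun 'I_n -> posint}) : rel 'I_n :=
  fun u v => G u v && (val (kappa u) < val (kappa v))%N.

Definition k_balanced_coloring n (k : nat) (G : rel 'I_n)
    (kappa : {ffun 'I_n -> posint}) : Prop :=
  proper_coloring G kappa /\ k_balanced k G (induced_orientation G kappa).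

Definition chromatic_qsym n (k : nat) (G : rel 'I_n) : series :=
  word_series [set kappa | k_balanced_coloring k G kappa].

(* Main.v *)
(* Direct, for each coloring kappa, the induced orientation O and label the
   vertices by a permutation w that decreases along O.  Sorting the vertices by
   color, ties being broken by w, gives a permutation s; reading the colors in
   that order gives a weakly increasing word that is strictly increasing at the
   descents of w along s.  Conversely, for fixed w and s every such word comes
   from a unique coloring, and if one coloring with data (O, s) is k-balanced
   then they all are, because the data determine the orientation.  So the
   k-balanced colorings with given (O, s) contribute either 0 or one
   fundamental quasisymmetric function, and c_a counts pairs (O, s). *)
Require Import Defs.
From mathcomp Require Import all_boot all_algebra perm zify finmap monalg.
From mathcomp Require Import boolp classical_sets functions cardinality fsbigop.

Set Implicit Arguments.
Unset Strict Implicit.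
Unset Printing Implicit Defensive.

Import GRing.Theory Num.Theory.

(** * Compositions of n as subsets of [n-1] *)

Definition proper_sums (s : seq nat) : seq nat :=
  [seq sumn (take l s) | l <- iota 1 (size s).-1].

Lemma proper_sums_cons x y s :
  proper_sums [:: x, y & s] = x :: [seq x + j | j <- proper_sums (y :: s)].
Proof.
rewrite /proper_sums /= addn0; congr (_ :: _).
by rewrite -[in LHS](addn1 1) iotaDl -!map_comp.
Qed.

Lemma proper_sums_bound s j :
  0 \notin s -> j \in proper_sums s -> 0 < j < sumn s.
Proof.
elim: s j => //= x [|y s] IHs j; first by rewrite in_nil.
rewrite in_cons negb_or => /andP[x0 s0]; rewrite proper_sums_cons in_cons.
have y0 : 0 < y by move: s0; rewrite in_cons negb_or; lia.
case/predU1P => [->|/mapP[i /(IHs _ s0) /= ? ->]]; first by rewrite /=; lia.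
lia.
Qed.

Lemma proper_sums_uniq s : 0 \notin s -> uniq (proper_sums s).
Proof.
elim: s => //= x [|y s] IHs //.
rewrite in_cons negb_or proper_sums_cons => /andP[_ s0] /=.
have {}IHs := IHs s0.
rewrite map_inj_uniq => [|i j /addnI //]; rewrite IHs andbT.
by apply/mapP => -[i /(proper_sums_bound s0)]; lia.
Qed.

(** With at least two parts, the first part is the least proper sum. So the heads agree, and
    subtracting the head leaves the tails. *)
Lemma proper_sums_inj s t : 0 \notin s -> 0 \notin t -> sumn s = sumn t ->
  proper_sums s =i proper_sums t -> s = t.
Proof.
elim: s t => [|x s IHs] [|y t] //;
  rewrite ?in_cons ?negb_or => s0 t0 /=; [lia|lia|].
move=> sum_st eq_st; case: s t IHs s0 t0 sum_st eq_st => [|x' s] [|y' t] IHs.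
- by rewrite /= !addn0 => _ _ ->.
- by move=> _ _ _ /(_ y); rewrite proper_sums_cons mem_head.
- by move=> _ _ _ /(_ x); rewrite proper_sums_cons mem_head.
rewrite !proper_sums_cons => /andP[x0 s0] /andP[y0 t0] sum_st eq_st.
have exy : x = y.
  have: x \in y :: [seq y + j | j <- proper_sums (y' :: t)].
    by rewrite -eq_st mem_head.
  have: y \in x :: [seq x + j | j <- proper_sums (x' :: s)].
    by rewrite eq_st mem_head.
  by rewrite !in_cons => /predU1P[//|/mapP[i _ ?]]
    /predU1P[//|/mapP[j _ ?]]; lia.
rewrite exy in sum_st eq_st *; congr (_ :: _); apply: IHs => // [|j].
  exact: addnI sum_st.
have := eq_st (y + j); rewrite !in_cons !(mem_map (@addnI y)).
(* At j = 0 the hypothesis only sees the common head and gives nothing; there positivity excludes 0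
   from both sets. *)
case: j => [_|j]; last by rewrite (_ : (y + j.+1 == y) = false) //; lia.
by apply/idP/idP => /proper_sums_bound; [move/(_ s0)|move/(_ t0)].
Qed.

(** Induction on n with S shifted down by one: prepend a part 1 if 1 is in S, and otherwise enlarge
    the first part by 1. *)
Lemma proper_sums_surj n (S : pred nat) : exists s : seq nat,
  [/\ 0 \notin s, sumn s = n
  & forall j, (j \in proper_sums s) = (0 < j < n) && S j].
Proof.
elim: n S => [|n IHn] S.
  by exists [::]; split=> // j; case: j.
have [[|x s] [s0 sum_s sP]] := IHn (fun j => S j.+1).
  exists [:: 1]; split=> //=; first by move: sum_s => /= <-.
  by move=> j; rewrite in_nil -sum_s; case: j => [|[]].
have [S1|nS1] := boolP (S 1).
  exists [:: 1, x & s]; split=> [||j].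
  - by rewrite in_cons.
  - by rewrite -sum_s.
  rewrite proper_sums_cons in_cons; case: j => [|[|j]] //=.
  - by apply/mapP => -[].
  - by rewrite -sum_s S1; move: s0; rewrite /= in_cons negb_or; lia.
  by rewrite (mem_map (@addnI 1)) sP.
exists (x.+1 :: s); split=> [||j].
- by move: s0; rewrite !in_cons !negb_or => /andP[_ ->].
- by rewrite -sum_s.
have psE : proper_sums (x.+1 :: s) = [seq 1 + j | j <- proper_sums (x :: s)].
  case: (s) => [|y t] //; rewrite 2!proper_sums_cons map_cons -map_comp.
  by rewrite add1n; congr (_ :: _).
rewrite psE; case: j => [|[|j]] /=.
- by apply/mapP => -[].
- rewrite (negbTE nS1) andbF; apply/mapP => -[[|i]] // /(proper_sums_bound s0).
  by [].
by rewrite (mem_map (@addnI 1)) sP.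
Qed.

(** Conditions on words and sortings are given at adjacent positions; this spreads them to all
    pairs. *)
Lemma ord_chain n (r : rel 'I_n) : transitive r ->
  (forall u v : 'I_n, val v = (val u).+1 -> r u v) ->
  forall u v : 'I_n, u < v -> r u v.
Proof.
move=> r_tr r_succ u v; have [d] := ubnP (v - u).
elim: d v => // d IHd v ltd luv; have [/esym/r_succ //|nSuv] := eqVneq u.+1 v.
have ltv : v.-1 < n by have := ltn_ord v; lia.
apply: (r_tr (Ordinal ltv)); last by apply: r_succ => /=; lia.
by apply: IHd => /=; lia.
Qed.

(** * Generating series of sets of words, coefficient by coefficient *)

Section WordSeries.
Local Open Scope ring_scope.
Variable n : nat.
Implicit Types (i : {ffun 'I_n -> posint}) (m : {cmonom posint}).

Lemma count_codom i (P : pred posint) :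
  count P (codom i) = (\sum_(j < n | P (i j)) 1)%N.
Proof. by rewrite codomE -sum1_count big_map big_enum_cond. Qed.

Lemma word_monomE i x : word_monom i x = count_mem x (codom i).
Proof.
rewrite count_codom big_mkcond /= /word_monom.
elim/big_ind2: _ => [|a1 b1 a2 b2 <- <-|j _]; [exact: cm1|exact: cmM|].
by rewrite cmU /=; case: eqP.
Qed.

Lemma eq_word_monom i i' :
  perm_eq (codom i) (codom i') = (word_monom i == word_monom i').
Proof.
apply/seq.permP/cmP => [ii' x|ii' P]; first by rewrite !word_monomE ii'.
have /seq.permP : perm_eq (codom i) (codom i').
  by apply/allP => x _ /=; rewrite -!word_monomE ii'.
exact.
Qed.

Lemma word_monom_perm i (s : 'S_n) :
  word_monom [ffun j => i (s j)] = word_monom i.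
Proof.
apply/eqP; rewrite -eq_word_monom; apply/seq.permP => P; rewrite !count_codom.
rewrite [RHS](reindex_inj (@perm_inj _ s)) /=.
by apply: eq_bigl => j; rewrite ffunE.
Qed.

(** The index set on the right depends on m only, so series of different sets can be compared term
    by term. *)
Lemma word_seriesE (A : set {ffun 'I_n -> posint}) m :
  word_series A m =
  \sum_(i <- fset_set [set i | word_monom i = m]%classic) (`[< A i >])%:R.
Proof.
have fin := @finite_word_monom n m; rewrite /word_series fsbig_mkcond.
rewrite (fsbigTE (fset_set [set i | word_monom i = m]%classic)) => [|i].
  rewrite [LHS]big_seq [RHS]big_seq; apply: eq_bigr => i.
  rewrite in_fset_set // inE /= => im; rewrite /patch im eqxx.
  by case: asboolP => Ai; [rewrite mem_set|rewrite memNset].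
rewrite in_fset_set // notin_setE /= /patch => /eqP/negPf ->.
by case: ifP.
Qed.

Lemma word_series_perm (A : set {ffun 'I_n -> posint}) (s : 'S_n) :
  word_series [set i | A [ffun j => i (s j)]]%classic = word_series A.
Proof.
apply/funext => m; rewrite !word_seriesE.
set W := fset_set _.
have fin := @finite_word_monom n m.
have WE i : (i \in W) = (word_monom i == m).
  by rewrite in_fset_set //; apply/idP/eqP; rewrite inE.
pose h (t : 'S_n) i : {ffun 'I_n -> posint} := [ffun j => i (t j)].
have hK (t t' : 'S_n) : (t * t' = 1)%g -> cancel (h t') (h t).
  move=> tt' i; apply/ffunP => j; rewrite !ffunE -permM tt' perm1.
  by [].
rewrite -[LHS](big_map (h s) xpredT (fun i => (`[< A i >])%:R)).
apply: perm_big; apply: uniq_perm; rewrite ?fset_uniq //.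
  by rewrite map_inj_uniq ?fset_uniq //; apply: can_inj (hK _ _ (mulVg s)).
move=> i; apply/mapP/idP => [[i' + ->]|]; rewrite !WE.
  by rewrite word_monom_perm.
by move=> im; exists (h s^-1%g i); rewrite ?WE ?word_monom_perm // hK ?mulgV.
Qed.

Lemma word_series_partition (T : finType) (A : set {ffun 'I_n -> posint})
    (B : T -> set {ffun 'I_n -> posint}) (f : {ffun 'I_n -> posint} -> T) :
  (forall t i, B t i <-> A i /\ f i = t) ->
  word_series A = \sum_t word_series (B t).
Proof.
move=> BP; apply/funext => m; rewrite fct_sumE word_seriesE.
under [RHS]eq_bigr do rewrite word_seriesE.
rewrite exchange_big; apply: eq_bigr => i _ /=.
case: asboolP => Ai; last first.
  by rewrite big1 // => t _; case: asboolP => // /BP[].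
rewrite (bigD1 (f i)) //= asboolT; last exact/BP.
rewrite big1 ?addr0 // => t nt; case: asboolP => // /BP[_ ft].
by rewrite ft eqxx in nt.
Qed.

Lemma word_series0 (A : set {ffun 'I_n -> posint}) :
  (forall i, ~ A i) -> word_series A = 0.
Proof.
move=> A0; apply/funext => m; rewrite word_seriesE big1 // => i _.
by rewrite asboolF.
Qed.

End WordSeries.

(** * Linear independence of the fundamental quasisymmetric functions *)

Section Fundamental.
Variable n : nat.
Implicit Types (a b : composition n) (i : {ffun 'I_n -> posint}).

Lemma compositionP a : 0 \notin parts a /\ sumn a = n.
Proof. by case: a => s /= /andP[s0 /eqP]. Qed.

Lemma partial_sums_bound a j : j \in partial_sums a -> 0 < j < n.
Proof. by have [a0 {2}<-] := compositionP a; apply: proper_sums_bound. Qed.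

Lemma partial_sums_inj a b : partial_sums a =i partial_sums b -> a = b.
Proof.
have [a0 an] := compositionP a; have [b0 bn] := compositionP b.
by move=> ab; apply/val_inj/proper_sums_inj; rewrite // an bn.
Qed.

Lemma partial_sums_surj (S : pred nat) :
  exists a, forall j, (j \in partial_sums a) = (0 < j < n) && S j.
Proof.
have [s [s0 sn sP]] := proper_sums_surj n S.
have comp_s : (0 \notin s) && (sumn s == n) by rewrite s0 sn eqxx.
by exists (Composition comp_s).
Qed.

Lemma fundamental_word_homo a i : fundamental_word a i ->
  forall u v : 'I_n, u <= v -> val (i u) <= val (i v).
Proof.
move=> ai u v; rewrite leq_eqVlt => /predU1P[/val_inj -> //|].
apply: (@ord_chain n (fun u v => val (i u) <= val (i v))) =>
  [y x z|{}u {}v /ai[]//].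
exact: leq_trans.
Qed.

Lemma sorted_codom i : (forall u v : 'I_n, u <= v -> val (i u) <= val (i v)) ->
  sorted leq (map val (codom i)).
Proof.
move=> i_homo; rewrite codomE -map_comp sorted_map.
apply: (@sub_sorted _ (relpre val leq)) => [u v /=|]; first exact: i_homo.
by rewrite -sorted_map val_enum_ord iota_sorted.
Qed.

(** A weakly increasing word is the sorted list of its letters, and the monomial records their
    multiset. *)
Lemma homo_word_monom_inj i i' :
  (forall u v : 'I_n, u <= v -> val (i u) <= val (i v)) ->
  (forall u v : 'I_n, u <= v -> val (i' u) <= val (i' v)) ->
  word_monom i = word_monom i' -> i = i'.
Proof.
move=> /sorted_codom si /sorted_codom si' /eqP; rewrite -eq_word_monom.
move=> /(perm_map val) /(sorted_eq leq_trans anti_leq si si').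
move=> /(inj_map val_inj); rewrite !codomE => /eq_in_map eq_ii'.
by apply/ffunP => u; apply: eq_ii'; rewrite mem_enum.
Qed.

(* The word with monomial x_1^{b_1} x_2^{b_2} ..., whose strict ascents are
   exactly the elements of S_b. *)
Definition staircase b : {ffun 'I_n -> posint} :=
  [ffun j : 'I_n => exist (fun m => 0 < m)
     (count (fun s => s <= j) (partial_sums b)).+1 isT].

Lemma fundamental_staircase a b :
  fundamental_word a (staircase b) <->
  {subset partial_sums a <= partial_sums b}.
Proof.
have countS (u : nat) (s : seq nat) :
    count (fun x => x <= u.+1) s = count (fun x => x <= u) s + count_mem u.+1 s.
  by elim: s => //= x s ->; lia.
split=> [ab j ja|ab u v uv].
  have /andP[j0 jn] := partial_sums_bound ja.
  (* The member j of S_a compares the 1-based entries j and j+1, which sit at indices j-1 and j. *)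
  have jn' : j.-1 < n by lia.
  have [] := ab (Ordinal jn') (Ordinal jn) => /=; first by lia.
  move=> _; rewrite prednK // => /(_ ja).
  rewrite !ffunE /= -{2}(prednK j0) countS prednK //.
  by rewrite -has_pred1 has_count; lia.
rewrite !ffunE /= uv countS ltnS leq_addr; split=> // /ab.
by rewrite -has_pred1 has_count ltnS -[X in _ -> X < _]addn0 ltn_add2l.
Qed.

Local Open Scope ring_scope.

(** Among the words with this monomial only the staircase is weakly increasing, so it alone can
    contribute. *)
Lemma fundamental_coef a b :
  fundamental a (word_monom (staircase b)) =
  (all (mem (partial_sums b)) (partial_sums a))%:R.
Proof.
rewrite /fundamental word_seriesE; set W := fset_set _.
have WE i : (i \in W) = (word_monom i == word_monom (staircase b)).
  rewrite in_fset_set; last exact: finite_word_monom.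
  by apply/idP/eqP; rewrite inE.
have bb : fundamental_word b (staircase b) by apply/fundamental_staircase.
rewrite (bigD1_seq (staircase b)) ?fset_uniq ?WE //= big_seq_cond big1 ?addr0.
  congr (nat_of_bool _)%:R.
  by apply/asboolP/allP => ab; apply/fundamental_staircase.
move=> i /andP[]; rewrite WE => /eqP ib /eqP nib; case: asboolP => // ai.
case: nib; apply: homo_word_monom_inj ib; first exact: fundamental_word_homo ai.
exact: fundamental_word_homo bb.
Qed.

Lemma L_expansion_coef (F : series) (c : composition n -> rat) b :
  L_expansion F c ->
  F (word_monom (staircase b)) =
  \sum_(a | all (mem (partial_sums b)) (partial_sums a)) c a.
Proof.
move=> ->; rewrite fct_sumE [RHS]big_mkcond; apply: eq_bigr => a _.
rewrite -[LHS]/(c a * fundamental a (word_monom (staircase b))).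
rewrite fundamental_coef.
by case: all; rewrite ?mulr1 ?mulr0.
Qed.

(* Evaluating at the monomial of [staircase b] is triangular with respect to
   inclusion of the sets S_a: look at a minimal b where c and c' differ. *)
Lemma L_expansion_inj (F : series) (c c' : composition n -> rat) :
  L_expansion F c -> L_expansion F c' -> c = c'.
Proof.
move=> Fc Fc'; apply/funext => a0; apply/eqP/negPn/negP => ne0.
have [b neb minb] := @arg_minnP _ a0 (fun a => c a != c' a)
  (fun a => size (partial_sums a)) ne0.
have D1 (d : composition n -> rat) :
    \sum_(a | all (mem (partial_sums b)) (partial_sums a)) d a =
    d b +
    \sum_(a | all (mem (partial_sums b)) (partial_sums a) && (a != b)) d a.
  by apply: bigD1; apply/allP.
have := L_expansion_coef b Fc; rewrite (L_expansion_coef b Fc') !D1.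
rewrite (eq_bigr c) => [/addIr/eqP|a /andP[/allP sab neab]].
  by rewrite eq_sym; exact/negP.
(* If c and c' differ at a, minimality makes S_a at least as large as S_b; being included in S_b, it
   equals S_b. *)
apply/esym/eqP/negPn/negP => /minb size_ba; case/eqP: neab.
apply: partial_sums_inj; have [a0' _] := compositionP a.
by case: (uniq_min_size (proper_sums_uniq a0') sab size_ba).
Qed.

End Fundamental.

(** * Standardization of a coloring *)

Section Standardization.
Variable n : nat.
Implicit Types (kappa : {ffun 'I_n -> posint}) (w s t : 'S_n).

(** Send each element to the number of elements below it. *)
Lemma rank_perm (r : rel 'I_n) : irreflexive r -> transitive r ->
  (forall u v, u != v -> r u v || r v u) ->
  exists s, forall u v, (s u < s v) = r u v.
Proof.
move=> r_irr r_tr r_total.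
have rank_ltn v : #|[set u | r u v]| < n.
  rewrite -[n in _ < n]card_ord -cardsT; apply: proper_card.
  apply/properP; split; first exact: finset.subsetT.
  by exists v; rewrite ?inE ?r_irr.
pose rank v := Ordinal (rank_ltn v).
have rank_homo u v : r u v -> rank u < rank v.
  move=> ruv; apply: proper_card; apply/properP; split.
    by apply/fintype.subsetP => x; rewrite !inE => /r_tr; apply.
  by exists u; rewrite !inE ?r_irr.
have rank_inj : injective rank.
  move=> u v eq_uv; apply/eqP/negPn/negP => /r_total /orP[] /rank_homo.
    by rewrite eq_uv ltnn.
  by rewrite eq_uv ltnn.
exists (perm rank_inj) => u v; rewrite !permE.
apply/idP/idP => [lt_uv|]; last exact: rank_homo.
have [euv|/r_total /orP[//|/rank_homo]] := eqVneq u v.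
  by rewrite euv ltnn in lt_uv.
by rewrite ltnNge (ltnW lt_uv).
Qed.

Lemma homo_perm_le t : (forall u v : 'I_n, (t u < t v) = (u < v)) ->
  forall u : 'I_n, u <= t u.
Proof.
move=> t_mono [u lt_un]; elim: u lt_un => // u IHu lt_un.
apply: leq_ltn_trans (IHu (ltnW lt_un)) _.
by rewrite t_mono.
Qed.

(** Both [s^-1 * t] and [t^-1 * s] preserve the order, so by [homo_perm_le] neither moves a point
    down. *)
Lemma perm_mono_inj s t : (forall u v, (s u < s v) = (t u < t v)) -> s = t.
Proof.
move=> st; apply/permP => u; apply/val_inj/eqP; rewrite /= eqn_leq.
have le_st s' t' : (forall u v, (s' u < s' v) = (t' u < t' v)) ->
    forall x, s' x <= t' x.
  move=> st' x; have := @homo_perm_le (s'^-1 * t')%g _ (s' x).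
  by rewrite permM permK; apply=> y z; rewrite !permM -st' !permKV.
by rewrite !le_st.
Qed.

Definition color_lt kappa w : rel 'I_n := fun u v =>
  (val (kappa u) < val (kappa v)) ||
  (val (kappa u) == val (kappa v)) && (w u < w v).

Lemma color_lt_irr kappa w : irreflexive (color_lt kappa w).
Proof. by move=> u; rewrite /color_lt !ltnn andbF. Qed.

Lemma color_lt_trans kappa w : transitive (color_lt kappa w).
Proof. by move=> v u x; rewrite /color_lt; lia. Qed.

Lemma color_lt_total kappa w u v :
  u != v -> color_lt kappa w u v || color_lt kappa w v u.
Proof. by rewrite -(inj_eq (@perm_inj _ w)) -val_eqE /color_lt /=; lia. Qed.

(** Sends a vertex to its position in the sorted order. The default is never taken, since [color_lt]
    is a strict total order. *)
Definition std kappa w : 'S_n :=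
  odflt 1%g [pick s : 'S_n |
    [forall u, forall v, (s u < s v) == color_lt kappa w u v]].

Lemma stdE kappa w u v : (std kappa w u < std kappa w v) = color_lt kappa w u v.
Proof.
rewrite /std; case: pickP => [s /forallP/(_ u)/forallP/(_ v)/eqP //|none].
have [s sP] := rank_perm (@color_lt_irr kappa w) (@color_lt_trans kappa w)
  (@color_lt_total kappa w).
have /negP[] := none s; apply/forallP => x; apply/forallP => y.
by rewrite sP.
Qed.

Lemma std_eq kappa w s :
  std kappa w = s <-> forall u v, (s u < s v) = color_lt kappa w u v.
Proof.
split=> [<- u v|sP]; first exact: stdE.
by apply: perm_mono_inj => u v; rewrite stdE sP.
Qed.

(** As [s^-1] lists the vertices by position, the left side says that this list is sorted for
    [color_lt]. By transitivity adjacent positions suffice, and there a tie in color is allowed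
    exactly where w ascends. *)
Lemma std_fiber w s : exists a : composition n, forall kappa,
  std kappa w = s <-> fundamental_word a [ffun j => kappa (s^-1%g j)].
Proof.
(* S_a is the descent set of w read along [s^-1]. *)
have [a aP] := partial_sums_surj n (fun j => [exists u : 'I_n, exists v : 'I_n,
  [&& u.+1 == j, v == j :> nat & w (s^-1%g v) < w (s^-1%g u)]]).
have descE (u v : 'I_n) : val v = (val u).+1 ->
    ((val u).+1 \in partial_sums a) = (w (s^-1%g v) < w (s^-1%g u)).
  move=> uv; rewrite aP.
  have -> : 0 < (val u).+1 < n by rewrite /= -uv (ltn_ord v).
  apply/existsP/idP => [[u' /existsP[v']]|desc].
    move=> /and3P[/eqP[/val_inj ->] /eqP v'u].
    by rewrite -uv in v'u; rewrite (val_inj v'u).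
  by exists u; apply/existsP; exists v; rewrite eqxx uv eqxx.
exists a => kappa; rewrite std_eq; split=> [sP u v uv|fund_a].
  rewrite (descE u v uv) !ffunE.
  have := sP (s^-1%g u) (s^-1%g v); rewrite !permKV uv ltnSn /color_lt.
  by move=> /esym; lia.
have chain (p q : 'I_n) : p < q -> color_lt kappa w (s^-1%g p) (s^-1%g q).
  apply: (@ord_chain n (fun p q => color_lt kappa w (s^-1%g p) (s^-1%g q))).
    by move=> y x z; apply: color_lt_trans.
  move=> u v uv; have [] := fund_a u v uv; rewrite (descE u v uv) !ffunE.
  have : w (s^-1%g u) != w (s^-1%g v) :> nat.
    by rewrite val_eqE !(inj_eq perm_inj) -val_eqE uv neq_ltn ltnSn.
  rewrite /color_lt; lia.
move=> u v; have [luv|lvu|/val_inj/perm_inj->] := ltngtP (s u) (s v).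
- by apply/esym; have := chain _ _ luv; rewrite !permK.
- apply/esym/negbTE/negP; have := chain _ _ lvu; rewrite !permK => vu uv.
  by have := color_lt_trans vu uv; rewrite color_lt_irr.
- by rewrite color_lt_irr.
Qed.

End Standardization.

(** * Fibers of colorings over an orientation and a permutation *)

Section Coloring.
Variables (n k : nat) (G : rel 'I_n).
Implicit Types (kappa : {ffun 'I_n -> posint}) (O : {ffun 'I_n * 'I_n -> bool}).

(** A finite function on pairs, so that orientations form a finite type that can index a sum. *)
Definition orientation_of kappa : {ffun 'I_n * 'I_n -> bool} :=
  [ffun p => induced_orientation G kappa p.1 p.2].

Lemma orientation_ofE kappa kappa' :
  orientation_of kappa = orientation_of kappa' ->
  induced_orientation G kappa = induced_orientation G kappa'.
Proof.
move=> /ffunP eqO; apply/funext => u; apply/funext => v.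
by have := eqO (u, v); rewrite !ffunE.
Qed.

(* A labeling that is order-reversing on the poset generated by O: with such
   labels, the strict P-partitions are the P-partitions. *)
Definition labeling O : 'S_n :=
  odflt 1%g [pick w : 'S_n | [forall u, forall v, O (u, v) ==> (w v < w u)]].

(** Colors increase along the orientation, so ranking the vertices by decreasing color is a valid
    choice and the default in [labeling] is not reached. *)
Lemma labelingP kappa u v : induced_orientation G kappa u v ->
  labeling (orientation_of kappa) v < labeling (orientation_of kappa) u.
Proof.
move=> Ouv; rewrite /labeling; case: pickP => [w|none].
  by move/forallP/(_ u)/forallP/(_ v); rewrite ffunE Ouv.
pose r x y := color_lt kappa 1 y x.
have [||x y|w wP] := @rank_perm n r.
- by move=> x; rewrite /r color_lt_irr.
- by move=> y x z; rewrite /r => yx zy; apply: color_lt_trans zy yx.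
- by rewrite eq_sym; apply: color_lt_total.
have /negP[] := none w; apply/forallP => x; apply/forallP => y; apply/implyP.
by rewrite ffunE wP /r /color_lt => /andP[_ ->].
Qed.

(** Along an edge from x to y the label drops, yet the common sorting puts x first. So x and y
    cannot be tied under [kappa']: its color strictly increases and the edge keeps its direction. *)
Lemma orientation_of_std kappa kappa' :
  symmetric G -> proper_coloring G kappa ->
  let w := labeling (orientation_of kappa) in std kappa' w = std kappa w ->
  orientation_of kappa' = orientation_of kappa.
Proof.
move=> G_sym kappa_proper w eq_std; apply/ffunP => -[u v]; rewrite !ffunE /=.
have transfer x y : induced_orientation G kappa x y ->
    val (kappa' x) < val (kappa' y).
  move=> Oxy; have := labelingP Oxy; rewrite -/w => wyx.
  have : std kappa' w x < std kappa' w y.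
    by rewrite eq_std stdE /color_lt; case/andP: Oxy => _ ->.
  by rewrite stdE /color_lt; lia.
rewrite /induced_orientation; case Guv: (G u v) => //=.
have Gvu : G v u by rewrite G_sym.
have := transfer u v; have := transfer v u.
rewrite /induced_orientation Guv Gvu /=.
have : val (kappa u) != val (kappa v) by rewrite val_eqE; apply: kappa_proper.
by move=> /=; lia.
Qed.

(** Equal colors on an edge would orient it neither way, while [kappa] orients every edge. *)
Lemma proper_coloring_orientation kappa kappa' :
  symmetric G -> proper_coloring G kappa ->
  orientation_of kappa' = orientation_of kappa -> proper_coloring G kappa'.
Proof.
move=> G_sym kappa_proper /orientation_ofE eqO u v Guv.
apply: contraTneq isT => eq'.
have Gvu : G v u by rewrite G_sym.
have neq_uv : val (kappa u) != val (kappa v).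
  by rewrite val_eqE; apply: kappa_proper.
have OE x y :
    induced_orientation G kappa' x y = induced_orientation G kappa x y.
  by rewrite eqO.
have := OE u v; have := OE v u.
by rewrite /induced_orientation Guv Gvu eq' ltnn /=; move: neq_uv => /=; lia.
Qed.

Local Open Scope ring_scope.

Lemma fiber_series (t : {ffun 'I_n * 'I_n -> bool} * 'S_n) : symmetric G ->
  exists ab : composition n * bool,
  word_series [set kappa | k_balanced_coloring k G kappa /\
    (orientation_of kappa, std kappa (labeling (orientation_of kappa)))
      = t]%classic
  = ab.2%:R *: fundamental ab.1.
Proof.
case: t => O s G_sym; set B := [set _ | _]%classic.
have [[kappa [[kappa_proper kappa_bal] [OE sE]]]|noB] :=
  pselect (exists kappa, B kappa).
  have [a aP] := std_fiber (labeling O) s.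
  exists (a, true); rewrite scale1r /fundamental.
  (* Permuting positions by [s^-1] turns a coloring into its word of colors in sorted order. *)
  rewrite -(word_series_perm [set i | fundamental_word a i]%classic s^-1%g).
  congr word_series; apply/seteqP; split=> kappa' /=.
    by case=> _ [OE' sE']; apply/aP; rewrite -OE'.
  (* One coloring [kappa] in the fiber suffices: [kappa'] has the same orientation, and this makes
     it proper and k-balanced too. *)
  move=> /aP sE'.
  have OE' : orientation_of kappa' = orientation_of kappa.
    by apply: orientation_of_std => //=; rewrite OE sE' -sE OE.
  rewrite /B /= OE' OE sE'; split=> //; split.
    exact: proper_coloring_orientation OE'.
  by rewrite (orientation_ofE OE').
(* For an empty fiber any composition serves, with coefficient 0. *)
have [a0 _] := partial_sums_surj n xpred0.
exists (a0, false); rewrite scale0r word_series0 // => kappa Bkappa.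
by case: noB; exists kappa.
Qed.

End Coloring.

Theorem theorem3p4 (n k : nat) (G : rel 'I_n)
    (G_sym : symmetric G) (G_irr : irreflexive G) (k_gt0 : 0 < k) :
  L_positive n (chromatic_qsym k G).
Proof.
have [ab abP] := choice (fun t => @fiber_series n k G t G_sym).
have expansion : L_expansion (chromatic_qsym k G)
    (fun a => \sum_(t | (ab t).1 == a) (ab t).2%:R)%R.
  rewrite /L_expansion /chromatic_qsym.
  rewrite (@word_series_partition n _ _ _ (fun kappa => (orientation_of G kappa,
    std kappa (labeling (orientation_of G kappa))))
    (fun t kappa => iff_refl _)).
  under eq_bigr do rewrite abP.
  (* Collect the fibers that share a composition; its coefficient is then a sum of zeros and
     ones. *)
  rewrite (partition_big (fun t => (ab t).1) xpredT) //=.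
  apply: eq_bigr => a _; rewrite scaler_suml.
  by apply: eq_bigr => t /eqP ->.
exists (fun a => \sum_(t | (ab t).1 == a) (ab t).2%:R)%R.
  by split=> // c'; apply: L_expansion_inj expansion.
by move=> a; apply: sumr_ge0 => t _; apply: ler0n.
Qed.
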